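(* Let $k\ge2$. There exist natural numbers $q_{n,j}$ ($n\ge1$, $1\le j\le k$) with $q_{1,1}<\cdots<q_{1,k}<q_{2,1}<\cdots<q_{2,k}<q_{3,1}<\cdots$, $q_{n,j}\mid q_{n,j+1}$ for $1\le j\le k-1$, $q_{n,k}\mid q_{n+1,1}$ for all $n$, and $\lim_{n\to\infty}b_{n+1}/b_n=\infty$ where $b_{(n-1)k+j}=\log q_{n,j}$, such that the numbers $\zeta_j=\sum_{n\ge1}1/q_{n,j}$ ($1\le j\le k$) together with $1$ are linearly independent over $\mathbb{Q}$ and satisfy $\underline\psi_1=-1$ and $\underline\psi_{j+1}=\overline\psi_j$ for $1\le j\le k$; consequently $$\underline\psi_1=-1,\quad \overline\psi_1=\underline\psi_2=\frac{1-k}{2k},\quad \overline\psi_j=\underline\psi_{j+1}=\frac1k\ (2\le j\le k),\quad \overline\psi_{k+1}=\frac1k.$$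
   Context: For $Q>1$ and $1\le j\le k+1$, $\psi_j(Q)$ is the minimum of all real $\theta$ such that the system $|x|\le Q^{1+\theta}$, $|\zeta_ix-y_i|\le Q^{-1/k+\theta}$ ($1\le i\le k$) has $j$ linearly independent solutions $(x,y_1,\dots,y_k)\in\mathbb{Z}^{k+1}$. Set $\underline\psi_j=\liminf_{Q\to\infty}\psi_j(Q)$ and $\overline\psi_j=\limsup_{Q\to\infty}\psi_j(Q)$. *)

(* Defs.v *)
From Stdlib Require Import Reals QArith Qreals Lra.
From Coquelicot Require Import Coquelicot.
Open Scope R_scope.

(* Integer vectors in Z^{k+1} are functions nat -> Z, coordinate 0 = x,
   coordinates 1..k = y_1..y_k.  A family of j such vectors is v : nat -> nat -> Z
   (v l is the l-th vector, l < j). *)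

Definition lin_indep (k j : nat) (v : nat -> nat -> Z) : Prop :=
  forall c : nat -> Z,
    (forall i, (i <= k)%nat ->
       sum_f_R0 (fun l => IZR (c l) * IZR (v l i)) (pred j) = 0) ->
    forall l, (l < j)%nat -> c l = 0%Z.

Definition psi_set (k : nat) (zeta : nat -> R) (j : nat) (Q : R) : R -> Prop :=
  fun theta => exists v : nat -> nat -> Z,
    lin_indep k j v /\
    forall l, (l < j)%nat ->
      Rabs (IZR (v l 0%nat)) <= Rpower Q (1 + theta) /\
      forall i, (1 <= i <= k)%nat ->
        Rabs (zeta i * IZR (v l 0%nat) - IZR (v l i)) <= Rpower Q (- (1 / INR k) + theta).

(* psi_j(Q): the minimum (= infimum) of that set *)
Definition psi (k : nat) (zeta : nat -> R) (j : nat) (Q : R) : R :=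
  real (Glb_Rbar (psi_set k zeta j Q)).

Definition is_liminf_infty (f : R -> R) (L : R) : Prop :=
  (forall eps, 0 < eps -> exists Q0, forall Q, Q0 <= Q -> L - eps <= f Q) /\
  (forall eps, 0 < eps -> forall Q0, exists Q, Q0 <= Q /\ f Q <= L + eps).

Definition is_limsup_infty (f : R -> R) (L : R) : Prop :=
  (forall eps, 0 < eps -> exists Q0, forall Q, Q0 <= Q -> f Q <= L + eps) /\
  (forall eps, 0 < eps -> forall Q0, exists Q, Q0 <= Q /\ L - eps <= f Q).

(* b_m for m >= 1: b_{(n-1)k+j} = log q_{n,j}, 1 <= j <= k *)
Definition bseq (k : nat) (q : nat -> nat -> nat) (m : nat) : R :=
  ln (INR (q (S ((m - 1) / k)) (S ((m - 1) mod k)))).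

Definition zeta_of (q : nat -> nat -> nat) (j : nat) : R :=
  Series (fun n => / INR (q (S n) j)).

Definition one_zeta (zeta : nat -> R) (i : nat) : R :=
  match i with O => 1 | _ => zeta i end.

(* Main.v *)
(** Take [q n j = 2 ^ ((n - 1) k + j)!], that is, [a m = 2 ^ m!] distributed cyclically over the
    [k] columns. Truncating the series at denominator [a m] gives an integer vector [P m] with
    first coordinate [a m] and errors at most [2 a m / a (m + 1)], and consecutive [P m] are
    independent. With [t = ln Q] and [b m = ln (a m)], on the window
    [b (m + 1) <= (1 + 1 / k) t <= b (m + 2)] the exponents of [P m] and [P (m + 1)] are
    [1 / k - b (m + 1) / t] and [b (m + 1) / t - 1] up to [o(1)], because [b m = o(b (m + 1))];
    they sum to [1 / k - 1], equal [-1] and [1 / k] at the left end of the window, and coincide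
    at [(1 + 1 / k) t = 2 b (m + 1)]. This gives all upper bounds.

    For the lower bounds, [k + 1] independent integer vectors have a determinant of absolute value
    at least [1], while the Leibniz formula bounds it by [(k + 1)! Q ^ s], where [s] is the sum of
    their exponents; so [s >= - o(1)]. By Steinitz exchange, vectors realising [psi j] may be
    combined with [P m], [P (m + 1)] and with the vectors [e_i] and [(1, up zeta_i)], all of
    exponent at most [1 / k].

    A rational relation between [1, zeta_1, ..., zeta_k] is an integral linear form whose values at
    [P m] tend to [0], hence eventually vanish; consecutive values isolate each coefficient. *)

Require Import Defs.
From Stdlib Require Import Reals QArith Qreals Lra Lia Classical ClassicalEpsilon Factorial.
From Coquelicot Require Import Coquelicot.
From HB Require structures.
From mathcomp Require all_boot all_order all_fingroup all_algebra Rstruct ssrZ.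
Open Scope R_scope.

(** * Integer matrices *)

Module IntegerMatrices.
Import structures all_boot all_order all_fingroup all_algebra ssrZ Rstruct.
Import Order.TTheory GRing.Theory Num.Theory.
Local Open Scope ring_scope.

Lemma IZR_is_zmod_morphism : zmod_morphism IZR.
Proof. by move=> x y; rewrite -[x - y]/(Z.sub x y) minus_IZR. Qed.

Lemma IZR_is_monoid_morphism : monoid_morphism IZR.
Proof. by split=> // x y; rewrite -[x * y]/(Z.mul x y) mult_IZR. Qed.

HB.instance Definition _ :=
  GRing.isZmodMorphism.Build Z R IZR IZR_is_zmod_morphism.
HB.instance Definition _ :=
  GRing.isMonoidMorphism.Build Z R IZR IZR_is_monoid_morphism.

Lemma sum_f_R0_bigE (f : nat -> R) n : sum_f_R0 f n = \sum_(i < n.+1) f i.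
Proof.
elim: n => [|n IHn] /=; first by rewrite big_ord_recl big_ord0 addr0.
by rewrite big_ord_recr /= -IHn.
Qed.

Lemma sum_f_R0_IZR (c v : nat -> Z) n :
  sum_f_R0 (fun l => Rmult (IZR (c l)) (IZR (v l))) n
  = IZR (\sum_(l < n.+1) c l * v l).
Proof.
rewrite sum_f_R0_bigE rmorph_sum; apply: eq_bigr => l _.
by rewrite rmorphM.
Qed.

(** Since [r < s], padding [c] with zero columns gives a square matrix whose last column is zero;
    its determinant vanishes, which yields an integral left kernel vector. *)
Lemma left_kernel_nonzero (r s : nat) (c : nat -> nat -> Z) : (r < s)%coq_nat ->
  exists e : nat -> Z,
    (exists l, (l < s)%coq_nat /\ e l <> Z0) /\
    forall i, (i < r)%coq_nat ->
      sum_f_R0 (fun l => Rmult (IZR (e l)) (IZR (c l i))) s.-1 = IZR Z0.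
Proof.
case: s => [/ssrnat.ltP//|s] /ssrnat.ltP lt_rs.
pose M : 'M[Z]_s.+1 := \matrix_(l, i) (if (i < r)%N then c l i else 0).
have detM : \det M == 0.
  rewrite -det_tr (expand_det_row _ ord_max) big1 // => j _.
  by rewrite !mxE /= ltnNge -ltnS lt_rs mul0r.
have /det0P[e e0 eM] := detM.
have [l el] : exists l, e ord0 l != 0.
  have /existsP[l el] : [exists l, e ord0 l != 0].
    apply: contraR e0 => /existsPn e0; apply/eqP/rowP => l.
    by have := e0 l; rewrite negbK mxE => /eqP.
  by exists l.
exists (fun l => e ord0 (inord l)); split.
  exists l; split; first exact/ssrnat.ltP.
  by rewrite inord_val; apply/eqP.
move=> i /ssrnat.ltP lt_ir; rewrite (sum_f_R0_IZR _ (c^~ i)); congr IZR.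
have lt_is : (i < s.+1)%N by apply: ltn_trans lt_ir lt_rs.
have := congr1 (fun A : 'rV_s.+1 => A ord0 (Ordinal lt_is)) eM.
rewrite !mxE; apply: etrans; apply: eq_bigr => l' _.
by rewrite inord_val mxE /= lt_ir.
Qed.

Lemma det_lin_indep (k : nat) (v : nat -> nat -> Z) : lin_indep k k.+1 v ->
  \det (\matrix_(l < k.+1, i < k.+1) v l i) != 0.
Proof.
move=> free_v; apply/negP => /det0P[e e0 eM]; case/negP: e0.
apply/eqP/rowP => l; rewrite mxE -[l in LHS]inord_val.
apply: (free_v (fun l => e ord0 (inord l))); last exact/ssrnat.ltP.
move=> i /ssrnat.leP le_ik; rewrite (sum_f_R0_IZR _ (v^~ i)) -[RHS]/(IZR Z0); congr IZR.
have := congr1 (fun A : 'rV_k.+1 => A ord0 (Ordinal (le_ik : (i < k.+1)%N))) eM.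
rewrite !mxE; apply: etrans; apply: eq_bigr => l' _.
by rewrite inord_val mxE.
Qed.

Lemma norm_IZR_ge1 (z : Z) : z != 0 -> 1 <= `|IZR z|.
Proof.
move=> z0; apply/RleP; rewrite -[`|_|]/(Rabs (IZR z)) -abs_IZR.
by apply: IZR_le; move/eqP: z0; rewrite -[0]/Z0; lia.
Qed.

(** Right multiplication by this matrix sends a row [(x, y_1, ..., y_k)] to
    [(x, zeta_1 x - y_1, ..., zeta_k x - y_k)], the quantities that [psi_set] bounds. *)
Definition shear (k : nat) (zeta : nat -> R) : 'M[R]_k.+1 :=
  \matrix_(i, j) if i == j then (if i == ord0 then 1 else -1)
                 else if i == ord0 then zeta j else 0.

Lemma norm_det_shear k zeta : `|\det (shear k zeta)| = 1.
Proof.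
rewrite -det_tr det_trig; last first.
  apply/is_trig_mxP => i j lt_ij; rewrite !mxE.
  have -> : (j == i) = false by apply/negP => /eqP eq_ji; rewrite eq_ji ltnn in lt_ij.
  by case: eqP => // j0; rewrite j0 in lt_ij.
rewrite normr_prod big1 // => i _; rewrite !mxE eqxx.
by case: ifP => _; rewrite ?normrN normr1.
Qed.

Lemma norm_det_le n (A : 'M[R]_n) (b : 'I_n -> 'I_n -> R) :
  (forall i j, `|A i j| <= b i j) ->
  `|\det A| <= \sum_(s : 'S_n) \prod_i b i (s i).
Proof.
move=> Ab; apply: le_trans (ler_norm_sum _ _ _) _; apply: ler_sum => s _.
rewrite normrM normr_sign mul1r normr_prod; apply: ler_prod => i _.
by rewrite normr_ge0 Ab.
Qed.

Lemma prod_exp n (f : 'I_n -> R) : \prod_i exp (f i) = exp (\sum_i f i).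
Proof. by rewrite (big_morph exp (fun x y => esym (expRD x y)) exp_0). Qed.

Lemma fact_factorial n : Factorial.fact n = n`!.
Proof. by elim: n => // n IHn; rewrite factS -IHn. Qed.

(** A nonzero integral determinant has absolute value at least [1], and the shear preserves it. Each
    Leibniz product takes one entry from every row and every column, so all of them obey the same
    bound. *)
Lemma independent_box_bound (k : nat) (zeta : nat -> R) (v : nat -> nat -> Z)
    (alpha beta : R) (th : nat -> R) :
  lin_indep k k.+1 v ->
  (forall l, (l < k.+1)%coq_nat ->
    Rle (Rabs (IZR (v l 0%N))) (exp (Rplus alpha (th l))) /\
    forall i, (1 <= i)%coq_nat /\ (i <= k)%coq_nat ->
      Rle (Rabs (Rminus (Rmult (zeta i) (IZR (v l 0%N))) (IZR (v l i))))
          (exp (Rplus beta (th l)))) ->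
  Rle R1 (Rmult (INR (Factorial.fact k.+1))
    (exp (Rplus (Rplus alpha (Rmult (INR k) beta)) (sum_f_R0 th k)))).
Proof.
move=> free_v bound_v.
pose M : 'M[Z]_k.+1 := \matrix_(l, i) v l i.
pose A : 'M[R]_k.+1 := map_mx IZR M.
have detA : 1 <= `|\det (A *m shear k zeta)|.
  rewrite det_mulmx normrM norm_det_shear mulr1 det_map_mx.
  exact/norm_IZR_ge1/det_lin_indep.
pose b (l i : 'I_k.+1) : R := exp ((if i == ord0 then alpha else beta) + th l).
have boundB l i : `|(A *m shear k zeta) l i| <= b l i.
  have [bound0 bound_i] := bound_v l (ssrnat.ltP (ltn_ord l)).
  rewrite mxE big_ord_recl /b !mxE.
  have [i' ->|->] := unliftP ord0 i; last first.
    rewrite big1 ?addr0 ?mulr1; first by apply/RleP.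
    by move=> j _; rewrite !mxE /= mulr0.
  rewrite (bigD1 i') //= big1 => [|j ne_ji]; last first.
    by rewrite !mxE (inj_eq lift_inj) (negPf ne_ji) mulr0.
  rewrite !mxE eqxx addr0 mulrN1 mulrC /= /bump leq0n add1n; apply/RleP.
  apply: (bound_i i'.+1); split; first exact/ssrnat.leP.
  exact/ssrnat.leP/(ltn_ord i').
have bE (s : 'S_k.+1) : \prod_l b l (s l) =
    exp (Rplus (Rplus alpha (Rmult (INR k) beta)) (sum_f_R0 th k)).
  rewrite prod_exp big_split /= sum_f_R0_bigE; congr (exp (_ + _)).
  (* Summed over columns instead of rows, column [0] gives [alpha] and the other [k] give [beta],
     whatever [s] is. *)
  rewrite (reindex_inj (@perm_inj _ (s^-1)%g)) /=.
  under eq_bigr do rewrite permKV.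
  rewrite big_ord_recl /= sumr_const card_ord.
  by rewrite INRE RmultE mulr_natl.
apply/RleP; apply: le_trans detA (le_trans (norm_det_le _ _ _ boundB) _).
under eq_bigr do rewrite bE.
rewrite sumr_const card_Sn -fact_factorial; set X := exp _.
by rewrite RmultE INRE mulr_natl.
Qed.

End IntegerMatrices.

(** * Independent families and successive minima *)

Lemma sum_f_R0_single (f : nat -> R) (n j : nat) : (j <= n)%nat ->
  (forall l, (l <= n)%nat -> l <> j -> f l = 0) -> sum_f_R0 f n = f j.
Proof.
  intros Hj H. induction n as [|n IH].
  - replace j with 0%nat by lia. reflexivity.
  - simpl. destruct (Nat.eq_dec j (S n)) as [->|Hne].
    + rewrite (sum_eq _ (fun _ => 0)), sum_cte.
      * ring.
      * intros l Hl. apply H; lia.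
    + rewrite IH, (H (S n)); try lia; try ring.
      intros l Hl Hlj. apply H; lia.
Qed.

Lemma sum_f_R0_switch (f : nat -> nat -> R) (n p : nat) :
  sum_f_R0 (fun l => sum_f_R0 (f l) p) n
  = sum_f_R0 (fun i => sum_f_R0 (fun l => f l i) n) p.
Proof.
  induction n as [|n IH]; simpl.
  - reflexivity.
  - rewrite IH, <- plus_sum. reflexivity.
Qed.

Definition extend {A : Type} (u : nat -> A) (r : nat) (w : A) : nat -> A :=
  fun l => if Nat.eqb l r then w else u l.

Lemma extend_eq {A : Type} (u : nat -> A) r w : extend u r w r = w.
Proof. unfold extend. now rewrite Nat.eqb_refl. Qed.

Lemma extend_neq {A : Type} (u : nat -> A) r w l : l <> r -> extend u r w l = u l.
Proof. intros H. unfold extend. now apply Nat.eqb_neq in H as ->. Qed.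

Lemma sum_f_R0_extend (u : nat -> R) r w : sum_f_R0 (extend u (S r) w) (S r) = sum_f_R0 u r + w.
Proof.
  simpl. rewrite extend_eq. f_equal.
  apply sum_eq. intros l Hl. apply extend_neq. lia.
Qed.

Lemma lin_indep_pred k r u : lin_indep k (S (S r)) u -> lin_indep k (S r) u.
Proof.
  intros H c Hc l Hl.
  rewrite <- (H (extend c (S r) 0%Z)) with (l := l); [|  |lia].
  - rewrite extend_neq; [reflexivity|lia].
  - intros i Hi. simpl. rewrite extend_eq. simpl in Hc.
    rewrite <- (Hc i Hi) at 2. rewrite Rmult_0_l, Rplus_0_r.
    apply sum_eq. intros l' Hl'. rewrite extend_neq; [reflexivity|lia].
Qed.

(* If no [w l] could be appended, each would have a multiple in the span of [u], with
   coefficients [C l]; an integer relation between the rows of [C] then yields one between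
   the [w l]. *)
Lemma lin_indep_exchange k r s u w : lin_indep k (S r) u -> lin_indep k s w -> (S r < s)%nat ->
  exists l, (l < s)%nat /\ lin_indep k (S (S r)) (extend u (S r) (w l)).
Proof.
  intros Hu Hw Hrs. apply NNPP. intros Hno.
  assert (Hdep : forall l, exists c : nat -> Z, (l < s)%nat ->
    c (S r) <> 0%Z /\
    forall i, (i <= k)%nat ->
      sum_f_R0 (fun j => IZR (c j) * IZR (u j i)) r + IZR (c (S r)) * IZR (w l i) = 0).
  { intros l. destruct (Nat.lt_ge_cases l s) as [Hl|Hl]; [|exists (fun _ => 0%Z); lia].
    assert (Hl' : ~ lin_indep k (S (S r)) (extend u (S r) (w l))).
    { intros H. apply Hno. exists l. now split. }
    apply not_all_ex_not in Hl' as [c Hc].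
    apply imply_to_and in Hc as [Hc Hc0].
    assert (Hc' : forall i, (i <= k)%nat ->
      sum_f_R0 (fun j => IZR (c j) * IZR (u j i)) r + IZR (c (S r)) * IZR (w l i) = 0).
    { intros i Hi. rewrite <- (Hc i Hi). simpl. rewrite extend_eq. f_equal.
      apply sum_eq. intros j Hj. rewrite extend_neq; [reflexivity|lia]. }
    exists c. intros _. split; [|exact Hc'].
    intros Hcr. apply Hc0. intros j Hj.
    destruct (Nat.eq_dec j (S r)) as [->|Hne]; [exact Hcr|].
    apply Hu; [|lia]. intros i Hi. simpl. specialize (Hc' i Hi).
    rewrite Hcr in Hc'. lra. }
  destruct (choice _ Hdep) as [C HC]. clear Hdep Hno.
  destruct (IntegerMatrices.left_kernel_nonzero (S r) s C Hrs) as [e [[l0 [Hl0 He0]] He]].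
  assert (Hz : (e l0 * C l0 (S r))%Z = 0%Z).
  { apply (Hw (fun l => (e l * C l (S r))%Z)); [|exact Hl0].
    intros i Hi.
    transitivity (- sum_f_R0 (fun l => IZR (e l) *
      sum_f_R0 (fun j => IZR (C l j) * IZR (u j i)) r) (pred s)).
    - apply Rminus_diag_uniq. unfold Rminus.
      rewrite Ropp_involutive, <- plus_sum, (sum_eq _ (fun _ => 0)), sum_cte; [ring|].
      intros l Hl. destruct (HC l) as [_ H]; [lia|]. specialize (H i Hi).
      rewrite mult_IZR, Rmult_assoc, <- Rmult_plus_distr_l, (Rplus_comm (_ * _)), H. ring.
    - rewrite (sum_eq _ (fun l => sum_f_R0 (fun j => IZR (e l) * IZR (C l j) * IZR (u j i)) r)).
      2: { intros l _. rewrite scal_sum. apply sum_eq. intros; ring. }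
      rewrite sum_f_R0_switch, (sum_eq _ (fun _ => 0)), sum_cte; [ring|].
      intros j Hj.
      rewrite <- (Rmult_0_r (IZR (u j i))), <- (He j), scal_sum by lia.
      reflexivity. }
  apply Z.mul_eq_0 in Hz as [Hz|Hz]; [now apply He0|].
  now destruct (HC l0 Hl0).
Qed.

(** * Exponents of integer vectors and the functions [psi] *)

Definition admissible (k : nat) (zeta : nat -> R) (Q theta : R) (w : nat -> Z) : Prop :=
  Rabs (IZR (w 0%nat)) <= Rpower Q (1 + theta) /\
  forall i, (1 <= i <= k)%nat ->
    Rabs (zeta i * IZR (w 0%nat) - IZR (w i)) <= Rpower Q (- (1 / INR k) + theta).

Lemma admissible_le k zeta Q th th' w : 1 <= Q -> th <= th' ->
  admissible k zeta Q th w -> admissible k zeta Q th' w.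
Proof.
  intros HQ Hth [H0 H]. split.
  - eapply Rle_trans; [exact H0|]. apply Rle_Rpower; lra.
  - intros i Hi. eapply Rle_trans; [exact (H i Hi)|]. apply Rle_Rpower; lra.
Qed.

(** At exponent [1 / k] the error bound is [Q ^ 0 = 1]. Unit vectors meet it, and so does
    [(1, up zeta_i)], since [up] moves a real by at most [1]. *)
Definition unit_box_family (zeta : nat -> R) (l i : nat) : Z :=
  match l with
  | O => match i with O => 1 | _ => up (zeta i) end
  | _ => if Nat.eqb l i then 1 else 0
  end.

Lemma unit_box_family_lin_indep k zeta : lin_indep k (S k) (unit_box_family zeta).
Proof.
  intros c Hc. simpl pred in Hc.
  assert (H0 : c 0%nat = 0%Z).
  { specialize (Hc 0%nat (Nat.le_0_l k)).
    rewrite (sum_f_R0_single _ _ 0) in Hc; [|lia|].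
    - apply eq_IZR. simpl in Hc. lra.
    - intros [|l] Hl Hl0; [lia|]. simpl. ring. }
  intros l Hl. destruct (Nat.eq_dec l 0) as [->|Hl0]; [exact H0|].
  specialize (Hc l ltac:(lia)).
  rewrite (sum_f_R0_single _ _ l) in Hc; [|lia|].
  - destruct l as [|l]; [lia|]. apply eq_IZR.
    unfold unit_box_family in Hc. rewrite Nat.eqb_refl in Hc. lra.
  - intros [|l'] Hl' Hne.
    + rewrite H0. ring.
    + unfold unit_box_family. apply Nat.eqb_neq in Hne as ->. ring.
Qed.

Lemma unit_box_family_admissible k zeta Q l : (1 <= k)%nat -> 1 <= Q ->
  admissible k zeta Q (1 / INR k) (unit_box_family zeta l).
Proof.
  intros Hk HQ.
  assert (Hk' : 0 < 1 / INR k).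
  { apply Rdiv_lt_0_compat; [lra|]. apply lt_0_INR. lia. }
  assert (H1 : 1 <= Rpower Q (1 + 1 / INR k)).
  { rewrite <- (Rpower_O Q) at 1 by lra. apply Rle_Rpower; lra. }
  split.
  - destruct l; simpl; rewrite ?Rabs_R0, ?Rabs_R1; lra.
  - intros i Hi. rewrite Rplus_opp_l, Rpower_O by lra.
    destruct l as [|l].
    + destruct i as [|i]; [lia|]. simpl.
      destruct (archimed (zeta (S i))). apply Rabs_le. lra.
    + unfold unit_box_family. destruct (Nat.eqb_spec (S l) 0); [lia|].
      destruct (Nat.eqb (S l) i); rewrite Rmult_0_r, Rminus_0_l, Rabs_Ropp, ?Rabs_R0, ?Rabs_R1; lra.
Qed.

(* The trivial half of Minkowski's second theorem, for a family completed by vectors of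
   exponent [1 / k]. *)
Lemma theta_sum_lower k zeta Q r u th : (1 <= k)%nat -> 1 < Q -> (r <= k)%nat ->
  lin_indep k (S r) u ->
  (forall l, (l < S r)%nat -> admissible k zeta Q (th l) (u l)) ->
  - ln (INR (fact (S k))) <= ln Q * (sum_f_R0 th r + (INR k - INR r) / INR k).
Proof.
  intros Hk HQ Hr. remember (k - r)%nat as d eqn:Hd.
  assert (Hk0 : 0 < INR k) by (apply lt_0_INR; lia).
  revert r u th Hr Hd. induction d as [|d IH]; intros r u th Hr Hd Hu Hadm.
  - replace r with k in * by lia.
    (* With these weights [alpha + k * beta = 0], so only the sum of the exponents remains. *)
    assert (Hdet := IntegerMatrices.independent_box_bound k zeta u (ln Q) (- (1 / INR k) * ln Q)
      (fun l => th l * ln Q) Hu).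
    assert (Hfact : 0 < INR (fact (S k))) by apply INR_fact_lt_0.
    apply Ropp_le_cancel. rewrite Ropp_involutive.
    rewrite <- (ln_exp (- (ln Q * _))).
    apply ln_le; [apply exp_pos|].
    rewrite exp_Ropp.
    apply (Rmult_le_reg_r (exp (ln Q * (sum_f_R0 th k + (INR k - INR k) / INR k)))); [apply exp_pos|].
    rewrite Rinv_l by apply Rgt_not_eq, exp_pos.
    eapply Rle_trans; [apply Hdet|].
    + intros l Hl. destruct (Hadm l Hl) as [H0 H]. split.
      * replace (ln Q + th l * ln Q) with ((1 + th l) * ln Q) by ring. exact H0.
      * intros i Hi.
        replace (- (1 / INR k) * ln Q + th l * ln Q) with ((- (1 / INR k) + th l) * ln Q) by ring.
        now apply H.
    + apply Req_le. f_equal. f_equal. rewrite <- scal_sum. field. lra.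
  - destruct (lin_indep_exchange k r (S k) u (unit_box_family zeta) Hu
      (unit_box_family_lin_indep k zeta)) as [l [Hl Hext]]; [lia|].
    assert (H := IH (S r) _ (extend th (S r) (1 / INR k)) ltac:(lia) ltac:(lia) Hext).
    rewrite sum_f_R0_extend, S_INR in H.
    eapply Rle_trans; [apply H|].
    + intros l' Hl'. destruct (Nat.eq_dec l' (S r)) as [->|Hne].
      * rewrite !extend_eq. apply unit_box_family_admissible; [exact Hk|lra].
      * rewrite !extend_neq by exact Hne. apply Hadm. lia.
    + apply Req_le. field. lra.
Qed.

Lemma psi_set_unit k zeta j Q : (1 <= k)%nat -> 1 <= Q -> (1 <= j <= S k)%nat ->
  psi_set k zeta j Q (1 / INR k).
Proof.
  intros Hk HQ Hj. exists (unit_box_family zeta). split.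
  - assert (H : forall d, (S d <= S k)%nat -> lin_indep k (S k - d) (unit_box_family zeta)).
    { induction d as [|d IH]; intros Hd.
      - rewrite Nat.sub_0_r. apply unit_box_family_lin_indep.
      - replace (S k - S d)%nat with (S (k - S d)) by lia. apply lin_indep_pred.
        replace (S (S (k - S d))) with (S k - d)%nat by lia. apply IH. lia. }
    replace j with (S k - (S k - j))%nat by lia. apply H. lia.
  - intros l _. now apply unit_box_family_admissible.
Qed.

(** Below [-1] both bounds are less than [1]. They force first [x = 0] and then every [y_i = 0], and
    a zero vector is not independent. *)
Lemma psi_set_ge_m1 k zeta j Q th : (1 <= k)%nat -> 1 < Q -> (1 <= j)%nat ->
  psi_set k zeta j Q th -> -1 <= th.
Proof.
  intros Hk HQ Hj [v [Hv Hadm]].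
  destruct (Rle_lt_dec (-1) th) as [H|Hth]; [exact H|exfalso].
  destruct (Hadm 0%nat Hj) as [H0 H].
  assert (Hk0 : 0 < 1 / INR k) by (apply Rdiv_lt_0_compat; [lra|apply lt_0_INR; lia]).
  assert (Hlt : forall x, x < 0 -> Rpower Q x < 1).
  { intros x Hx. rewrite <- (Rpower_O Q) by lra. apply Rpower_lt; lra. }
  assert (Hz : forall z, Rabs (IZR z) < 1 -> z = 0%Z).
  { intros z Hz. rewrite <- abs_IZR in Hz. apply lt_IZR in Hz. lia. }
  assert (Hx0 : v 0%nat 0%nat = 0%Z).
  { apply Hz. eapply Rle_lt_trans; [exact H0|]. apply Hlt. lra. }
  assert (Hv0 : forall i, (i <= k)%nat -> v 0%nat i = 0%Z).
  { intros i Hi. destruct (Nat.eq_dec i 0) as [->|Hi0]; [exact Hx0|].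
    apply Hz. specialize (H i ltac:(lia)).
    rewrite Hx0, Rmult_0_r, Rminus_0_l, Rabs_Ropp in H.
    eapply Rle_lt_trans; [exact H|]. apply Hlt. lra. }
  assert (H1 : (1 = 0)%Z); [|discriminate].
  apply (Hv (fun l => if Nat.eqb l 0 then 1 else 0)%Z) with (l := 0%nat); [|exact Hj].
  intros i Hi. rewrite (sum_f_R0_single _ _ 0); [|lia|].
  - rewrite (Hv0 i Hi). ring.
  - intros l _ Hl. apply Nat.eqb_neq in Hl as ->. ring.
Qed.

(** The set contains [1 / k] and is bounded below by [-1]. This excludes infinite infima, which
    [real] would silently turn into [0]. *)
Lemma psi_finite k zeta j Q : (1 <= k)%nat -> 1 < Q -> (1 <= j <= S k)%nat ->
  Glb_Rbar (psi_set k zeta j Q) = Finite (psi k zeta j Q).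
Proof.
  intros Hk HQ Hj. unfold psi.
  destruct (Glb_Rbar_correct (psi_set k zeta j Q)) as [Hlb Hglb].
  assert (H1 := Hlb _ (psi_set_unit k zeta j Q Hk (Rlt_le _ _ HQ) Hj)).
  assert (H2 : Rbar_le (-1) (Glb_Rbar (psi_set k zeta j Q))).
  { apply Hglb. intros th Hth. exact (psi_set_ge_m1 k zeta j Q th Hk HQ (proj1 Hj) Hth). }
  destruct (Glb_Rbar (psi_set k zeta j Q)); [reflexivity|destruct H1|destruct H2].
Qed.

Lemma psi_le k zeta j Q th : (1 <= k)%nat -> 1 < Q -> (1 <= j <= S k)%nat ->
  psi_set k zeta j Q th -> psi k zeta j Q <= th.
Proof.
  intros Hk HQ Hj Hth.
  destruct (Glb_Rbar_correct (psi_set k zeta j Q)) as [Hlb _].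
  specialize (Hlb _ Hth). now rewrite psi_finite in Hlb.
Qed.

Lemma psi_ge k zeta j Q m : (1 <= k)%nat -> 1 < Q -> (1 <= j <= S k)%nat ->
  (forall th, psi_set k zeta j Q th -> m <= th) -> m <= psi k zeta j Q.
Proof.
  intros Hk HQ Hj Hm.
  destruct (Glb_Rbar_correct (psi_set k zeta j Q)) as [_ Hglb].
  specialize (Hglb m Hm). now rewrite psi_finite in Hglb.
Qed.

(** * Limits from good pairs of vectors *)

Lemma lin_indep_second k P : lin_indep k 2 P -> lin_indep k 1 (fun _ => P 1%nat).
Proof.
  intros HP c Hc l Hl. replace l with 0%nat by lia.
  apply (HP (fun l => if Nat.eqb l 0 then 0%Z else c 0%nat)) with (l := 1%nat); [|lia].
  intros i Hi. specialize (Hc i Hi). simpl in *. lra.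
Qed.

(* [w] is the logarithm to base [Q] of the denominator of the second vector; the exponents of
   the two vectors add up to about [1 / k - 1]. *)
Definition good_pair (k : nat) (zeta : nat -> R) (eps Q w : R) : Prop :=
  1 < Q /\ ln (INR (fact (S k))) <= eps * ln Q /\
  exists P : nat -> nat -> Z, lin_indep k 2 P /\
    admissible k zeta Q (1 / INR k - w + eps) (P 0%nat) /\
    admissible k zeta Q (w - 1 + eps) (P 1%nat).

Lemma ln_pos Q : 1 < Q -> 0 < ln Q.
Proof. intros H. rewrite <- ln_1. apply ln_increasing; lra. Qed.

(** Division by [ln Q] turns the constant [ln (k + 1)!] into an error of at most [eps]. *)
Lemma good_pair_theta_sum k zeta eps Q w r u th :
  good_pair k zeta eps Q w -> (1 <= k)%nat -> (r <= k)%nat -> lin_indep k (S r) u ->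
  (forall l, (l < S r)%nat -> admissible k zeta Q (th l) (u l)) ->
  - eps <= sum_f_R0 th r + (INR k - INR r) / INR k.
Proof.
  intros [HQ [Hfact _]] Hk Hr Hu Hadm.
  assert (H := theta_sum_lower k zeta Q r u th Hk HQ Hr Hu Hadm).
  apply (Rmult_le_reg_l (ln Q)); [now apply ln_pos|]. lra.
Qed.

Section GoodPair.
Context (k : nat) (zeta : nat -> R) (eps Q w : R).
Context (hk : (2 <= k)%nat) (Hgood : good_pair k zeta eps Q w).

Let Hk : (1 <= k)%nat := Nat.lt_le_incl 1 k hk.

Let HK : 2 <= INR k.
Proof. apply (le_INR 2). exact hk. Qed.

Let HQ1 : 1 < Q := proj1 Hgood.

Lemma good_pair_psi_1_le : psi k zeta 1 Q <= 1 / INR k - w + eps.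
Proof.
  pose proof Hgood as [_ [_ [P [HP [H0 _]]]]].
  apply psi_le; [exact Hk|exact HQ1|lia|].
  exists P. split; [now apply lin_indep_pred|].
  intros l Hl. now replace l with 0%nat by lia.
Qed.

(** The smaller of two exponents with sum [1 / k - 1] is at most half of that sum; either vector may
    be the better one. *)
Lemma good_pair_psi_1_le_mean : psi k zeta 1 Q <= (1 - INR k) / (2 * INR k) + eps.
Proof.
  assert (Hm : (1 - INR k) / (2 * INR k) = (1 / INR k - 1) / 2) by (field; lra).
  rewrite Hm.
  destruct (Rle_lt_dec (1 / INR k - w) (w - 1)) as [Hw|Hw].
  - eapply Rle_trans; [apply good_pair_psi_1_le|]. lra.
  - apply Rle_trans with (w - 1 + eps); [|lra].
    pose proof Hgood as [_ [_ [P [HP [_ H1]]]]].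
    apply psi_le; [exact Hk|exact HQ1|lia|].
    exists (fun _ => P 1%nat). split; [now apply lin_indep_second|].
    intros l _. exact H1.
Qed.

Lemma good_pair_psi_2_le b : 1 / INR k - w <= b -> w - 1 <= b -> psi k zeta 2 Q <= b + eps.
Proof.
  intros Hb0 Hb1. pose proof Hgood as [_ [_ [P [HP [H0 H1]]]]].
  apply psi_le; [exact Hk|exact HQ1|lia|].
  exists P. split; [exact HP|]. intros l Hl.
  assert (Hl' : l = 0%nat \/ l = 1%nat) by lia.
  destruct Hl' as [-> | ->].
  - apply (admissible_le _ _ _ _ _ _ (Rlt_le _ _ HQ1)) with (2 := H0). lra.
  - apply (admissible_le _ _ _ _ _ _ (Rlt_le _ _ HQ1)) with (2 := H1). lra.
Qed.

(** A vector realising [th] is independent of some vector of the pair, whose exponent is at most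
    [b + eps]; a much smaller [th] would violate the determinant bound. *)
Lemma good_pair_psi_1_ge b : 1 / INR k - w <= b -> w - 1 <= b ->
  1 / INR k - 1 - b - 2 * eps <= psi k zeta 1 Q.
Proof.
  intros Hb0 Hb1. pose proof Hgood as [_ [_ [P [HP [H0 H1]]]]].
  apply psi_ge; [exact Hk|exact HQ1|lia|]. intros th [v [Hv Hadm]].
  destruct (lin_indep_exchange k 0 2 v P Hv HP) as [l [Hl Hext]]; [lia|].
  assert (Hl' : admissible k zeta Q (b + eps) (P l)).
  { assert (Hl' : l = 0%nat \/ l = 1%nat) by lia. destruct Hl' as [-> | ->].
    - apply (admissible_le _ _ _ _ _ _ (Rlt_le _ _ HQ1)) with (2 := H0). lra.
    - apply (admissible_le _ _ _ _ _ _ (Rlt_le _ _ HQ1)) with (2 := H1). lra. }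
  assert (H := good_pair_theta_sum _ _ _ _ _ 1 _ (fun l => match l with O => th | _ => b + eps end)
    Hgood Hk Hk Hext).
  simpl in H.
  replace ((INR k - 1) / INR k) with (1 - 1 / INR k) in H by (field; lra).
  enough (- eps <= th + (b + eps) + (1 - 1 / INR k)) by lra.
  apply H. intros [|l'] Hl''.
  - apply Hadm. lia.
  - replace l' with 0%nat by lia. exact Hl'.
Qed.

Lemma good_pair_psi_2_ge : (1 - INR k) / (2 * INR k) - eps / 2 <= psi k zeta 2 Q.
Proof.
  apply psi_ge; [exact Hk|exact HQ1|lia|]. intros th [v [Hv Hadm]].
  assert (H := good_pair_theta_sum _ _ _ _ _ 1 _ (fun _ => th) Hgood Hk Hk Hv Hadm).
  simpl in H.
  replace ((INR k - 1) / INR k) with (1 - 1 / INR k) in H by (field; lra).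
  replace ((1 - INR k) / (2 * INR k)) with ((1 / INR k - 1) / 2) by (field; lra).
  lra.
Qed.

(** Among two or more independent vectors one is independent of [P 0], and the determinant bound
    balances its exponent against [1 / k - w]. At [w = 1 + 1 / k] the resulting bound tends to
    [1 / k]. *)
Lemma good_pair_psi_ge j : (2 <= j <= S k)%nat -> w - 1 - 2 * eps <= psi k zeta j Q.
Proof.
  intros Hj. pose proof Hgood as [_ [_ [P [HP [H0 _]]]]].
  apply psi_ge; [exact Hk|exact HQ1|lia|]. intros th [v [Hv Hadm]].
  destruct (lin_indep_exchange k 0 j P v (lin_indep_pred _ _ _ HP) Hv) as [l [Hl Hext]]; [lia|].
  assert (H := good_pair_theta_sum _ _ _ _ _ 1 _
    (fun l => match l with O => 1 / INR k - w + eps | _ => th end) Hgood Hk Hk Hext).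
  simpl in H.
  replace ((INR k - 1) / INR k) with (1 - 1 / INR k) in H by (field; lra).
  enough (- eps <= 1 / INR k - w + eps + th + (1 - 1 / INR k)) by lra.
  apply H. intros [|l'] Hl''.
  - exact H0.
  - replace l' with 0%nat by lia. now apply Hadm.
Qed.

(** Among three or more independent vectors one is independent of the whole pair. Since the
    exponents of the pair have a sum free of [w], so is the bound on the third. *)
Lemma good_pair_psi_ge_unit j : (3 <= j <= S k)%nat -> 1 / INR k - 3 * eps <= psi k zeta j Q.
Proof.
  intros Hj. pose proof Hgood as [_ [_ [P [HP [H0 H1]]]]].
  apply psi_ge; [exact Hk|exact HQ1|lia|]. intros th [v [Hv Hadm]].
  destruct (lin_indep_exchange k 1 j P v HP Hv) as [l [Hl Hext]]; [lia|].
  assert (H := good_pair_theta_sum _ _ _ _ _ 2 _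
    (fun l => match l with O => 1 / INR k - w + eps | 1%nat => w - 1 + eps | _ => th end)
    Hgood Hk hk Hext).
  simpl in H.
  replace ((INR k - (1 + 1)) / INR k) with (1 - 2 * (1 / INR k)) in H by (field; lra).
  enough (- eps <= 1 / INR k - w + eps + (w - 1 + eps) + th + (1 - 2 * (1 / INR k))) by lra.
  apply H. intros [|[|l']] Hl''.
  - exact H0.
  - exact H1.
  - replace l' with 0%nat by lia. now apply Hadm.
Qed.

End GoodPair.

Definition eventually_good (k : nat) (zeta : nat -> R) : Prop :=
  forall eps, 0 < eps -> exists Q0, forall Q, Q0 <= Q -> exists w, good_pair k zeta eps Q w.

(** Two values of [w] matter: [1 + 1 / k] gives exponents [-1] and [1 / k], and half of it makes
    both exponents equal to [(1 / k - 1) / 2]. *)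
Definition frequently_good (k : nat) (zeta : nat -> R) (w : R) : Prop :=
  forall eps, 0 < eps -> forall Q0, exists Q, Q0 <= Q /\ good_pair k zeta eps Q w.

Section Limits.
Context (k : nat) (zeta : nat -> R) (hk : (2 <= k)%nat).
Context (Hev : eventually_good k zeta).
Context (Hmin : frequently_good k zeta (1 + 1 / INR k)).
Context (Hmid : frequently_good k zeta ((1 + 1 / INR k) / 2)).

Let HK : 2 <= INR k.
Proof. apply (le_INR 2). exact hk. Qed.

Let Hmean : (1 - INR k) / (2 * INR k) = (1 / INR k - 1) / 2.
Proof. field. lra. Qed.

Lemma psi_le_unit j Q : (1 <= j <= S k)%nat -> 1 < Q -> psi k zeta j Q <= 1 / INR k.
Proof.
  intros Hj HQ. apply psi_le; [lia|exact HQ|exact Hj|].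
  apply psi_set_unit; [lia|lra|exact Hj].
Qed.

Lemma liminf_psi_1 : is_liminf_infty (psi k zeta 1) (-1).
Proof.
  split; intros eps Heps.
  - exists 2. intros Q HQ. apply Rle_trans with (-1); [lra|].
    apply psi_ge; [lia|lra|lia|]. intros th Hth.
    apply (psi_set_ge_m1 k zeta 1 Q th); [lia|lra|lia|exact Hth].
  - intros Q0. destruct (Hmin eps Heps Q0) as [Q [HQ Hgood]].
    exists Q. split; [exact HQ|].
    assert (H := good_pair_psi_1_le _ _ _ _ _ hk Hgood). lra.
Qed.

Lemma limsup_psi_1 : is_limsup_infty (psi k zeta 1) ((1 - INR k) / (2 * INR k)).
Proof.
  split; intros eps Heps.
  - destruct (Hev eps Heps) as [Q0 HQ0]. exists Q0. intros Q HQ.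
    destruct (HQ0 Q HQ) as [w Hgood]. now apply good_pair_psi_1_le_mean with w.
  - intros Q0. destruct (Hmid (eps / 2) ltac:(lra) Q0) as [Q [HQ Hgood]].
    exists Q. split; [exact HQ|].
    assert (H := good_pair_psi_1_ge _ _ _ _ _ hk Hgood ((1 / INR k - 1) / 2)
      ltac:(lra) ltac:(lra)). lra.
Qed.

Lemma liminf_psi_2 : is_liminf_infty (psi k zeta 2) ((1 - INR k) / (2 * INR k)).
Proof.
  split; intros eps Heps.
  - destruct (Hev eps Heps) as [Q0 HQ0]. exists Q0. intros Q HQ.
    destruct (HQ0 Q HQ) as [w Hgood].
    assert (H := good_pair_psi_2_ge _ _ _ _ _ hk Hgood). lra.
  - intros Q0. destruct (Hmid eps Heps Q0) as [Q [HQ Hgood]].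
    exists Q. split; [exact HQ|]. rewrite Hmean.
    apply (good_pair_psi_2_le _ _ _ _ _ hk Hgood); lra.
Qed.

Lemma limsup_psi_unit j : (2 <= j <= S k)%nat -> is_limsup_infty (psi k zeta j) (1 / INR k).
Proof.
  intros Hj. split; intros eps Heps.
  - exists 2. intros Q HQ. assert (H := psi_le_unit j Q ltac:(lia) ltac:(lra)). lra.
  - intros Q0. destruct (Hmin (eps / 2) ltac:(lra) Q0) as [Q [HQ Hgood]].
    exists Q. split; [exact HQ|].
    assert (H := good_pair_psi_ge _ _ _ _ _ hk Hgood j Hj). lra.
Qed.

Lemma liminf_psi_unit j : (3 <= j <= S k)%nat -> is_liminf_infty (psi k zeta j) (1 / INR k).
Proof.
  intros Hj. split; intros eps Heps.
  - destruct (Hev (eps / 3) ltac:(lra)) as [Q0 HQ0]. exists Q0. intros Q HQ.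
    destruct (HQ0 Q HQ) as [w Hgood].
    assert (H := good_pair_psi_ge_unit _ _ _ _ _ hk Hgood j Hj). lra.
  - intros Q0. exists (Rmax Q0 2). split; [apply Rmax_l|].
    assert (H2 := Rmax_r Q0 2).
    assert (H := psi_le_unit j (Rmax Q0 2) ltac:(lia) ltac:(lra)). lra.
Qed.

End Limits.

(** * The lacunary series *)

Definition den (m : nat) : nat := 2 ^ fact m.

Definition log_den (m : nat) : R := INR (fact m) * ln 2.

(** Residues are taken on both sides because column [k] has residue [0]. *)
Definition hits (k i m : nat) : bool := Nat.eqb (m mod k) (i mod k).

(* The numerator over [den m] of the partial sum of [zeta i] up to denominators at most [den m]. *)
Fixpoint num (k i m : nat) : Z :=
  match m with
  | O => 0
  | S p => num k i p * Z.of_nat (2 ^ (fact (S p) - fact p)) + (if hits k i (S p) then 1 else 0)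
  end.

Definition approximant (k m i : nat) : Z :=
  match i with O => Z.of_nat (den m) | _ => num k i m end.

Lemma den_S m : den (S m) = (2 ^ (fact (S m) - fact m) * den m)%nat.
Proof.
  unfold den. rewrite <- Nat.pow_add_r. f_equal.
  assert (fact m <= fact (S m))%nat by (apply fact_le; lia). lia.
Qed.

Lemma ln2_pos : 0 < ln 2.
Proof. apply ln_pos. lra. Qed.

Lemma exp_le x y : x <= y -> exp x <= exp y.
Proof.
  intros [H| ->]; [|apply Rle_refl]. now apply Rlt_le, exp_increasing.
Qed.

Lemma INR_den m : INR (den m) = exp (log_den m).
Proof.
  unfold den, log_den. rewrite pow_INR.
  rewrite <- (Rpower_pow (fact m) (INR 2)); [|simpl; lra].
  reflexivity.
Qed.

Lemma INR_den_pos m : 0 < INR (den m).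
Proof. rewrite INR_den. apply exp_pos. Qed.

Lemma log_den_S m : log_den (S m) = INR (S m) * log_den m.
Proof. unfold log_den. rewrite fact_simpl, mult_INR. ring. Qed.

Lemma log_den_ge m : ln 2 <= log_den m.
Proof.
  unfold log_den. assert (H := lt_O_fact m). apply (le_INR 1) in H. simpl in H.
  assert (H2 := ln2_pos). nra.
Qed.

Lemma log_den_ge_INR m : INR m * ln 2 <= log_den m.
Proof.
  apply Rmult_le_compat_r; [apply Rlt_le, ln2_pos|]. apply le_INR.
  destruct m as [|m]; [lia|]. rewrite fact_simpl. assert (H := lt_O_fact m). nia.
Qed.

Lemma num_S k i m :
  IZR (num k i (S m)) / INR (den (S m))
  = IZR (num k i m) / INR (den m) + (if hits k i (S m) then / INR (den (S m)) else 0).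
Proof.
  simpl num. assert (H := INR_den_pos m).
  assert (H2 : 0 < INR (2 ^ (fact (S m) - fact m))).
  { apply lt_0_INR. apply Nat.neq_0_lt_0, Nat.pow_nonzero. lia. }
  change (fact m + m * fact m)%nat with (fact (S m)).
  rewrite den_S, mult_INR, plus_IZR, mult_IZR, <- INR_IZR_INZ.
  destruct (hits k i (S m)); field; split; lra.
Qed.

Lemma mod_neq_of_close k x y : (x < y < x + k)%nat -> (y mod k)%nat <> (x mod k)%nat.
Proof.
  intros H E. assert (k <> 0)%nat by lia.
  assert (Hx := Nat.div_mod x k ltac:(lia)). assert (Hy := Nat.div_mod y k ltac:(lia)).
  rewrite E in Hy. destruct (Nat.le_gt_cases (y / k) (x / k)); nia.
Qed.

Lemma hits_close k i x y : (x < y < x + k)%nat -> hits k i x = true -> hits k i y = false.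
Proof.
  unfold hits. intros H Hx. apply Nat.eqb_eq in Hx. apply Nat.eqb_neq. rewrite <- Hx.
  now apply mod_neq_of_close.
Qed.

Lemma hits_arith k i n : hits k i (n * k + i) = true.
Proof. apply Nat.eqb_eq. rewrite Nat.add_comm. apply Nat.Div0.mod_add. Qed.

(** Column [i] receives a term exactly at the indices [N * k + i]. Both claims go through one
    induction, because the first partial sum starts from the numerator [0]. *)
Lemma num_partial_sum k i m : (1 <= i <= k)%nat ->
  ((m < i)%nat -> num k i m = 0%Z) /\
  (forall N, (N * k + i <= m < S N * k + i)%nat ->
    IZR (num k i m) / INR (den m) = sum_f_R0 (fun n => / INR (den (n * k + i))) N).
Proof.
  intros Hi. induction m as [|m [IH0 IHN]].
  - split; [reflexivity|]. intros N HN. lia.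
  - split.
    + intros Hm. simpl num. rewrite IH0 by lia.
      replace (hits k i (S m)) with false; [reflexivity|].
      symmetry. unfold hits. apply Nat.eqb_neq. apply not_eq_sym, mod_neq_of_close. lia.
    + intros N HN. rewrite num_S.
      destruct (Nat.eq_dec (S m) (N * k + i)) as [Hm|Hm].
      * rewrite Hm, hits_arith. destruct N as [|N].
        -- rewrite IH0 by lia. simpl. unfold Rdiv. ring.
        -- rewrite (IHN N) by lia. reflexivity.
      * rewrite (hits_close k i (N * k + i) (S m)); [|lia|apply hits_arith].
        rewrite (IHN N) by lia. ring.
Qed.

Lemma den_le p p' : (p <= p')%nat -> INR (den p) <= INR (den p').
Proof.
  intros H. apply le_INR, Nat.pow_le_mono_r; [lia|]. now apply fact_le.
Qed.

(** From [p >= 1] on, each step raises the factorial by at least [1], so [n * k] steps at least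
    double the denominator [n] times. This dominates every tail by a geometric series. *)
Lemma den_growth p n k : (1 <= p)%nat -> (1 <= k)%nat ->
  / INR (den (p + n * k)) <= / INR (den p) * (/ 2) ^ n.
Proof.
  intros Hp Hk. rewrite pow_inv, <- Rinv_mult.
  assert (H2 : 0 < 2 ^ n) by (apply pow_lt; lra). assert (Hd := INR_den_pos p).
  apply Rinv_le_contravar; [nra|].
  replace (2 ^ n) with (INR (2 ^ n)) by (rewrite pow_INR; reflexivity).
  rewrite <- mult_INR. apply le_INR. unfold den. rewrite <- Nat.pow_add_r.
  apply Nat.pow_le_mono_r; [lia|].
  assert (H : forall d, (fact p + d <= fact (p + d))%nat).
  { induction d as [|d IH]; [rewrite !Nat.add_0_r; lia|].
    rewrite (Nat.add_succ_r p d), fact_simpl. assert (H := lt_O_fact (p + d)). nia. }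
  specialize (H (n * k)%nat). nia.
Qed.

Definition reciprocals (k i n : nat) : R := / INR (den (n * k + i)).

Lemma ex_series_reciprocals_from k i p : (1 <= i)%nat -> (1 <= k)%nat ->
  ex_series (fun n => reciprocals k i (p + n)) /\
  0 <= Series (fun n => reciprocals k i (p + n)) <= 2 / INR (den (p * k + i)).
Proof.
  intros Hi Hk.
  assert (Hterm : forall n, 0 <= reciprocals k i (p + n)
    <= / INR (den (p * k + i)) * (/ 2) ^ n).
  { intros n. unfold reciprocals. split.
    - apply Rlt_le, Rinv_0_lt_compat, INR_den_pos.
    - replace ((p + n) * k + i)%nat with ((p * k + i) + n * k)%nat by ring.
      apply den_growth; [lia|exact Hk]. }
  assert (Hgeom : is_series (fun n => / INR (den (p * k + i)) * (/ 2) ^ n)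
    (/ INR (den (p * k + i)) * / (1 - / 2))).
  { apply (is_series_scal_l (/ INR (den (p * k + i))) (fun n => (/ 2) ^ n)).
    apply is_series_geom. rewrite Rabs_pos_eq; lra. }
  assert (Hex : ex_series (fun n => reciprocals k i (p + n))).
  { apply (@ex_series_le R_AbsRing R_CompleteNormedModule) with (2 := ex_intro _ _ Hgeom).
    intros n. change (Rabs (reciprocals k i (p + n)) <= / INR (den (p * k + i)) * (/ 2) ^ n).
    rewrite Rabs_pos_eq; apply Hterm. }
  split; [exact Hex|]. split.
  - rewrite <- (Rmult_0_l (Series (fun n => reciprocals k i (p + n)))), <- Series_scal_l.
    apply Series_le; [|exact Hex]. intros n. specialize (Hterm n). lra.
  - replace (2 / INR (den (p * k + i))) with (/ INR (den (p * k + i)) * / (1 - / 2)).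
    2: { assert (H := INR_den_pos (p * k + i)). field. lra. }
    rewrite <- (is_series_unique _ _ Hgeom).
    apply Series_le; [exact Hterm|now exists (/ INR (den (p * k + i)) * / (1 - / 2))].
Qed.

Lemma ex_series_reciprocals k i : (1 <= i)%nat -> (1 <= k)%nat -> ex_series (reciprocals k i).
Proof. intros Hi Hk. apply (ex_series_reciprocals_from k i 0 Hi Hk). Qed.

(** The right side is [2 * den m / den (S m)]: the omitted tail is at most twice its first term,
    whose index is at least [S m]. *)
Lemma approximant_error k i m : (1 <= i <= k)%nat -> (k <= m)%nat ->
  Rabs (Series (reciprocals k i) * INR (den m) - IZR (num k i m))
  <= exp (ln 2 + log_den m - log_den (S m)).
Proof.
  intros Hi Hm.
  (* [N] is the last summand of column [i] with index at most [m]; the subtraction is not truncated,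
     as [i <= k <= m]. *)
  set (N := ((m - i) / k)%nat).
  assert (HN : (N * k + i <= m < S N * k + i)%nat).
  { assert (H1 := Nat.div_mod (m - i) k ltac:(lia)).
    assert (H2 := Nat.mod_upper_bound (m - i) k ltac:(lia)). fold N in H1. nia. }
  destruct (num_partial_sum k i m Hi) as [_ Hsum]. specialize (Hsum N HN).
  destruct (ex_series_reciprocals_from k i (S N)) as [_ [H0 H2]]; [lia|lia|].
  assert (Hd := INR_den_pos m).
  rewrite (Series_incr_n _ (S N)); [|lia|apply ex_series_reciprocals; lia].
  simpl pred. unfold reciprocals at 1. rewrite <- Hsum.
  set (T := Series (fun n => reciprocals k i (S N + n))) in *.
  replace ((IZR (num k i m) / INR (den m) + T) * INR (den m) - IZR (num k i m))
    with (T * INR (den m)) by (field; lra).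
  rewrite Rabs_pos_eq by nra.
  unfold Rminus. rewrite !exp_plus, exp_Ropp, exp_ln, <- !INR_den by lra.
  rewrite Rmult_assoc, (Rmult_comm (INR (den m))), <- Rmult_assoc.
  apply Rmult_le_compat_r; [lra|].
  eapply Rle_trans; [exact H2|]. apply Rmult_le_compat_l; [lra|].
  apply Rinv_le_contravar; [apply INR_den_pos|]. apply den_le. lia.
Qed.

Lemma approximant_admissible k zeta m Q th : (k <= m)%nat ->
  (forall i, (1 <= i <= k)%nat -> zeta i = Series (reciprocals k i)) ->
  log_den m <= (1 + th) * ln Q ->
  ln 2 + log_den m - log_den (S m) <= (- (1 / INR k) + th) * ln Q ->
  admissible k zeta Q th (approximant k m).
Proof.
  intros Hm Hzeta H0 H1. unfold admissible, Rpower. simpl approximant.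
  rewrite <- INR_IZR_INZ. split.
  - rewrite Rabs_pos_eq by apply Rlt_le, INR_den_pos. rewrite INR_den.
    now apply exp_le.
  - intros i Hi. rewrite (Hzeta i Hi). destruct i as [|i]; [lia|].
    eapply Rle_trans; [now apply approximant_error|]. now apply exp_le.
Qed.

(** Column [S (m mod k)] is the one hit at index [S m]. Its minor with coordinate [0] equals
    [den m], hence is nonzero, and eliminating [c0] leaves [c1 * den m = 0]. *)
Lemma approximant_step k m c0 c1 : (1 <= k)%nat ->
  (forall i, (i <= k)%nat ->
    IZR c0 * IZR (approximant k m i) + IZR c1 * IZR (approximant k (S m) i) = 0) ->
  c1 = 0%Z.
Proof.
  intros Hk Hc.
  assert (H0 := Hc 0%nat ltac:(lia)). assert (H1 := Hc (S (m mod k))).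
  assert (Hmod := Nat.mod_upper_bound m k ltac:(lia)).
  specialize (H1 ltac:(lia)). unfold approximant in H0, H1.
  rewrite <- !INR_IZR_INZ in H0.
  assert (Hs := num_S k (S (m mod k)) m).
  replace (hits k (S (m mod k)) (S m)) with true in Hs.
  2: { symmetry. apply Nat.eqb_eq. rewrite <- (Nat.add_1_r m), <- (Nat.add_1_r (m mod k)).
       symmetry. apply Nat.Div0.add_mod_idemp_l. }
  assert (Hd := INR_den_pos m). assert (Hd' := INR_den_pos (S m)).
  set (x := IZR (num k (S (m mod k)) m)) in *. set (x' := IZR (num k (S (m mod k)) (S m))) in *.
  set (d := INR (den m)) in *. set (d' := INR (den (S m))) in *.
  assert (Hx : x' * d = x * d' + d).
  { replace x' with (x' / d' * d') by (field; lra). rewrite Hs. field. lra. }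
  apply eq_IZR.
  assert (Hprod : IZR c1 * d = 0); [|nra].
  replace (IZR c1 * d) with (IZR c1 * (x' * d) - IZR c1 * d' * x) by (rewrite Hx; ring).
  replace (IZR c1 * d') with (- (IZR c0 * d)) by lra.
  replace (IZR c1 * (x' * d)) with (- (IZR c0 * x) * d) by nra. ring.
Qed.

Lemma approximants_lin_indep k m : (1 <= k)%nat ->
  lin_indep k 2 (fun l => approximant k (l + m)).
Proof.
  intros Hk c Hc. simpl in Hc.
  assert (H1 := approximant_step k m (c 0%nat) (c 1%nat) Hk Hc).
  assert (H0 := Hc 0%nat ltac:(lia)). rewrite H1 in H0. simpl in H0.
  rewrite <- INR_IZR_INZ in H0. assert (Hd := INR_den_pos m).
  intros l Hl. assert (Hl' : l = 0%nat \/ l = 1%nat) by lia. destruct Hl' as [-> | ->].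
  - apply eq_IZR. nra.
  - exact H1.
Qed.

(** * Windows of [Q] and their good pairs *)

Lemma good_pair_window k zeta m Q eps : (1 <= k)%nat -> (k <= m)%nat ->
  (forall i, (1 <= i <= k)%nat -> zeta i = Series (reciprocals k i)) ->
  1 < Q -> ln (INR (fact (S k))) <= eps * ln Q -> 6 <= eps * INR (S m) ->
  log_den (S m) <= (1 + 1 / INR k) * ln Q <= log_den (S (S m)) ->
  good_pair k zeta eps Q (log_den (S m) / ln Q).
Proof.
  intros Hk Hm Hzeta HQ Hfact Heps [Hlo Hhi].
  assert (Ht := ln_pos Q HQ). assert (HB := log_den_ge m). assert (H2 := ln2_pos).
  assert (HK : 1 <= INR k) by (apply (le_INR 1); exact Hk).
  assert (HK1 : 1 / INR k <= 1).
  { apply (Rmult_le_reg_l (INR k)); [lra|]. field_simplify; lra. }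
  assert (HS : 0 < INR (S m)) by (apply lt_0_INR; lia).
  (* As [(m + 1) * log_den m = log_den (S m) <= 2 * ln Q], the constant [6] gives
     [3 * log_den m <= eps * ln Q], and [ln 2 <= log_den m]. *)
  assert (Hepst : ln 2 + log_den m <= eps * ln Q).
  { assert (Heps0 : 0 < eps) by nra.
    assert (log_den (S m) <= 2 * ln Q) by nra.
    rewrite log_den_S in *.
    assert (6 * log_den m <= eps * (INR (S m) * log_den m)) by nra.
    nra. }
  assert (Hw : log_den (S m) / ln Q * ln Q = log_den (S m)) by (field; lra).
  split; [exact HQ|]. split; [exact Hfact|].
  exists (fun l => approximant k (l + m)). split; [now apply approximants_lin_indep|].
  set (w := log_den (S m) / ln Q) in *. clearbody w.
  (* The lower end of the window serves the first coordinate of the vector at [m], the upper end the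
     errors of the vector at [S m]; [Hepst] absorbs the rest. *)
  split; apply approximant_admissible; cbn [Nat.add]; try lia; try exact Hzeta; lra.
Qed.

Lemma nat_large (n : nat) (x : R) : exists m, (n <= m)%nat /\ x <= INR m.
Proof.
  destruct (INR_unbounded x) as [p Hp]. exists (Nat.max n p). split; [lia|].
  apply Rle_trans with (INR p); [lra|]. apply le_INR. lia.
Qed.

(** The intervals between consecutive values cover the half-line from [log_den (S M)]. The induction
    lowers an upper index until the interval ending there contains [x]. *)
Lemma log_den_window M x : log_den (S M) <= x ->
  exists m, (M <= m)%nat /\ log_den (S m) <= x <= log_den (S (S m)).
Proof.
  intros HM. assert (H2 := ln2_pos).
  destruct (nat_large 0 (x / ln 2)) as [n [_ Hn]].
  assert (Hx : x <= log_den (n + S M)).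
  { eapply Rle_trans; [|apply log_den_ge_INR].
    replace x with (x / ln 2 * ln 2) by (field; lra).
    apply Rmult_le_compat_r; [lra|]. apply Rle_trans with (1 := Hn). apply le_INR. lia. }
  clear Hn. induction n as [|n IH].
  - exists M. split; [lia|]. split; [exact HM|].
    eapply Rle_trans; [exact Hx|]. cbn [Nat.add]. rewrite (log_den_S (S M)), S_INR.
    assert (H := log_den_ge (S M)). assert (H1 := pos_INR (S M)). nra.
  - destruct (Rle_lt_dec x (log_den (n + S M))) as [H|H]; [now apply IH|].
    exists (n + M)%nat. split; [lia|]. rewrite Nat.add_succ_r in H.
    rewrite Nat.add_succ_l, Nat.add_succ_r in Hx. split; [lra|exact Hx].
Qed.

Lemma ln_fact_ge0 n : 0 <= ln (INR (fact n)).
Proof.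
  rewrite <- ln_1. apply ln_le; [lra|]. apply (le_INR 1), lt_O_fact.
Qed.

Section Goodness.
Context (k : nat) (zeta : nat -> R) (Hk : (1 <= k)%nat).
Context (Hzeta : forall i, (1 <= i <= k)%nat -> zeta i = Series (reciprocals k i)).

Let HK0 : 0 < INR k.
Proof. apply lt_0_INR. exact Hk. Qed.

Let HK : 0 < 1 / INR k.
Proof. apply Rdiv_lt_0_compat; lra. Qed.

Lemma eventually_good_of_reciprocals : eventually_good k zeta.
Proof.
  intros eps Heps. set (C := ln (INR (fact (S k)))).
  assert (HC : 0 <= C) by apply ln_fact_ge0.
  assert (HCe : 0 <= C / eps) by now apply Rdiv_le_0_compat.
  destruct (nat_large k (6 / eps)) as [M [HM Heps6]].
  assert (HB := log_den_ge (S M)). assert (H2 := ln2_pos).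
  (* The first summand makes the factorial term at most [eps * ln Q]; the second forces the window
     index to be at least [M]. *)
  exists (exp (C / eps + log_den (S M))). intros Q HQ.
  assert (HlnQ : C / eps + log_den (S M) <= ln Q).
  { rewrite <- (ln_exp (C / eps + log_den (S M))). apply ln_le; [apply exp_pos|exact HQ]. }
  assert (HQ1 : 1 < Q).
  { eapply Rlt_le_trans; [|exact HQ]. rewrite <- exp_0. apply exp_increasing. lra. }
  destruct (log_den_window M ((1 + 1 / INR k) * ln Q)) as [m [Hm Hwin]]; [nra|].
  exists (log_den (S m) / ln Q).
  apply good_pair_window; try assumption; try lia.
  - fold C. replace C with (eps * (C / eps)) by (field; lra).
    apply Rmult_le_compat_l; lra.
  - replace 6 with (eps * (6 / eps)) by (field; lra).
    apply Rmult_le_compat_l; [lra|]. apply Rle_trans with (1 := Heps6). apply le_INR. lia.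
Qed.

(** Here [Q] is chosen with [(1 + 1 / k) * ln Q = lam * log_den (S m)]. It stays in the window for
    [1 <= lam <= 2], since the next [log_den] is at least twice as large. *)
Lemma frequently_good_of_reciprocals lam : 1 <= lam <= 2 ->
  frequently_good k zeta ((1 + 1 / INR k) / lam).
Proof.
  intros Hlam eps Heps Q0. set (C := ln (INR (fact (S k)))).
  assert (HC : 0 <= C) by apply ln_fact_ge0.
  assert (HCe : 0 <= C / eps) by now apply Rdiv_le_0_compat.
  assert (HK1 : 1 / INR k <= 1).
  { assert (H1 : 1 <= INR k) by (apply (le_INR 1); exact Hk).
    apply (Rmult_le_reg_l (INR k)); [lra|]. field_simplify; lra. }
  assert (H2 := ln2_pos). assert (H6 : 0 < 6 / eps) by (apply Rdiv_lt_0_compat; lra).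
  assert (HQ0 := Rabs_pos Q0).
  (* The first summand meets the condition with [6]; the second makes [t] at least
     [C / eps + Rabs Q0], which absorbs the factorial and yields [Q0 <= exp t]. *)
  destruct (nat_large k (6 / eps + (C / eps + Rabs Q0) * 2 / ln 2)) as [m [Hm Hlarge]].
  assert (H0 : 0 <= (C / eps + Rabs Q0) * 2 / ln 2) by (apply Rdiv_le_0_compat; lra).
  set (t := lam * log_den (S m) / (1 + 1 / INR k)).
  assert (Ht : (1 + 1 / INR k) * t = lam * log_den (S m)) by (unfold t; field; split; lra).
  assert (HB := log_den_ge (S m)).
  assert (Ht1 : log_den (S m) <= 2 * t) by nra.
  assert (Ht2 : C / eps + Rabs Q0 <= t).
  { assert (HBm := log_den_ge_INR (S m)). rewrite S_INR in HBm.
    assert (Hm2 : (C / eps + Rabs Q0) * 2 / ln 2 * ln 2 <= INR m * ln 2)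
      by (apply Rmult_le_compat_r; lra).
    replace ((C / eps + Rabs Q0) * 2 / ln 2 * ln 2) with ((C / eps + Rabs Q0) * 2) in Hm2
      by (field; lra). lra. }
  assert (Htpos : 0 < t) by lra.
  assert (HSS : 2 * log_den (S m) <= log_den (S (S m))).
  { rewrite (log_den_S (S m)), !S_INR. assert (H := pos_INR m). nra. }
  exists (exp t). split.
  - assert (H := exp_ineq1_le t). assert (H' := Rle_abs Q0). lra.
  - replace ((1 + 1 / INR k) / lam) with (log_den (S m) / ln (exp t)).
    2: { rewrite ln_exp. apply (Rmult_eq_reg_r (lam * t)); [|nra].
         transitivity (lam * log_den (S m)); [field; lra|]. rewrite <- Ht. field. split; lra. }
    apply good_pair_window; rewrite ?ln_exp; try assumption.
    + rewrite <- exp_0. now apply exp_increasing.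
    + fold C. replace C with (eps * (C / eps)) by (field; lra).
      apply Rmult_le_compat_l; lra.
    + replace 6 with (eps * (6 / eps)) by (field; lra).
      apply Rmult_le_compat_l; [lra|]. rewrite S_INR. lra.
    + rewrite Ht. split; nra.
Qed.

(** * Linear independence over the rationals *)

Lemma relation_approximants (z : nat -> Z) :
  sum_f_R0 (fun i => IZR (z i) * one_zeta zeta i) k = 0 ->
  exists M, forall m, (M <= m)%nat ->
    sum_f_R0 (fun i => IZR (z i) * IZR (approximant k m i)) k = 0.
Proof.
  intros Hz. set (W := sum_f_R0 (fun i => Rabs (IZR (z i))) k).
  assert (HW : 0 <= W) by (apply cond_pos_sum; intros; apply Rabs_pos).
  assert (H2 := ln2_pos).
  destruct (nat_large k (W / ln 2 + 1)) as [M [HMk HM]]. exists M. intros m Hm.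
  set (E := exp (ln 2 + log_den m - log_den (S m))).
  assert (HWE : W * E < 1).
  { set (y := log_den (S m) - log_den m - ln 2).
    (* The difference of logarithms is [m * log_den m], so [y >= (m - 1) * ln 2 >= W]; then
       [exp y >= 1 + y > W]. *)
    assert (Hy : W <= y).
    { unfold y. rewrite log_den_S, S_INR. assert (HB := log_den_ge m).
      assert (HMm := le_INR _ _ Hm).
      assert (HWl : W / ln 2 * ln 2 <= (INR m - 1) * ln 2) by (apply Rmult_le_compat_r; lra).
      replace (W / ln 2 * ln 2) with W in HWl by (field; lra).
      assert (0 <= W / ln 2) by (apply Rdiv_le_0_compat; lra).
      nra. }
    replace E with (/ exp y) by (unfold E, y; rewrite <- exp_Ropp; f_equal; ring).
    assert (Hexp := exp_ineq1_le y).
    apply (Rmult_lt_reg_r (exp y)); [apply exp_pos|].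
    rewrite Rmult_assoc, Rinv_l by apply Rgt_not_eq, exp_pos. lra. }
  destruct (ex_intro (fun n => _ = IZR n) _
    (IntegerMatrices.sum_f_R0_IZR z (approximant k m) k)) as [n Hn]. rewrite Hn.
  enough (Hlt : Rabs (IZR n) < 1).
  { rewrite <- abs_IZR in Hlt. apply lt_IZR in Hlt. f_equal. lia. }
  eapply Rle_lt_trans; [|exact HWE]. rewrite <- Hn.
  (* Subtracting [den m] times the relation [Hz] replaces each coordinate by its approximation
     error. *)
  rewrite <- (Rminus_0_r (sum_f_R0 _ k)), <- (Rmult_0_r (INR (den m))), <- Hz, scal_sum, <- minus_sum.
  eapply Rle_trans; [apply Rsum_abs|].
  unfold W. rewrite Rmult_comm, scal_sum. apply sum_Rle. intros i Hi.
  replace (IZR (z i) * IZR (approximant k m i) - IZR (z i) * one_zeta zeta i * INR (den m))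
    with (- (IZR (z i) * (one_zeta zeta i * INR (den m) - IZR (approximant k m i)))) by ring.
  rewrite Rabs_Ropp, Rabs_mult. apply Rmult_le_compat_l; [apply Rabs_pos|].
  destruct i as [|i].
  - simpl. rewrite <- INR_IZR_INZ, Rmult_1_l, Rminus_diag, Rabs_R0. apply Rlt_le, exp_pos.
  - simpl one_zeta. rewrite Hzeta by lia. apply approximant_error; lia.
Qed.

(** Once normalised by their denominators, consecutive approximants differ only in the column just
    hit, so two vanishing values of the form isolate that coefficient. Coordinate [0] then remains
    alone. *)
Lemma one_zeta_free_Z (z : nat -> Z) :
  sum_f_R0 (fun i => IZR (z i) * one_zeta zeta i) k = 0 ->
  forall i, (i <= k)%nat -> z i = 0%Z.
Proof.
  intros Hz. destruct (relation_approximants z Hz) as [M HM].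
  assert (Hpos : forall i, (1 <= i <= k)%nat -> z i = 0%Z).
  { intros i Hi.
    (* This choice gives [S m = M * k + i], so passing from [m] to [S m] hits column [i]. *)
    set (m := (M * k + (i - 1))%nat). assert (HMm : (M <= m)%nat) by (unfold m; nia).
    assert (H0 := HM m HMm). assert (H1 := HM (S m) ltac:(lia)).
    assert (Hd := INR_den_pos m). assert (Hd' := INR_den_pos (S m)).
    assert (H : sum_f_R0 (fun i' => IZR (z i') * (IZR (approximant k (S m) i') / INR (den (S m))
        - IZR (approximant k m i') / INR (den m))) k = 0).
    { rewrite (sum_eq _ (fun i' => IZR (z i') * IZR (approximant k (S m) i') * / INR (den (S m))
        - IZR (z i') * IZR (approximant k m i') * / INR (den m))).
      - rewrite minus_sum, <- !scal_sum, H0, H1. ring.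
      - intros; field; lra. }
    assert (Hhit : hits k i (S m) = true).
    { replace (S m) with (M * k + i)%nat by (unfold m; lia). apply hits_arith. }
    rewrite (sum_f_R0_single _ _ i) in H; [|lia|].
    - destruct i as [|i]; [lia|]. unfold approximant in H. rewrite num_S, Hhit in H.
      apply eq_IZR. apply (Rmult_eq_reg_r (/ INR (den (S m)))).
      + rewrite Rmult_0_l, <- H. ring.
      + apply Rgt_not_eq, Rinv_0_lt_compat, Hd'.
    - intros [|i'] Hi' Hne.
      + unfold approximant. rewrite <- !INR_IZR_INZ. field. lra.
      + unfold approximant. rewrite num_S.
        replace (hits k (S i') (S m)) with false; [ring|].
        symmetry. apply Nat.eqb_neq. apply Nat.eqb_eq in Hhit. rewrite Hhit.
        destruct (Nat.lt_ge_cases (S i') i).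
        * apply mod_neq_of_close. lia.
        * apply not_eq_sym, mod_neq_of_close. lia. }
  intros i Hi. destruct (Nat.eq_dec i 0) as [->|Hi0]; [|apply Hpos; lia].
  specialize (HM M (Nat.le_refl M)). rewrite (sum_f_R0_single _ _ 0) in HM; [|lia|].
  - unfold approximant in HM. rewrite <- INR_IZR_INZ in HM.
    assert (Hd := INR_den_pos M). apply eq_IZR. nra.
  - intros l Hl Hl0. rewrite Hpos by lia. ring.
Qed.

End Goodness.

Lemma common_denominator (c : nat -> Q) n : exists (d : Z) (z : nat -> Z), d <> 0%Z /\
  forall i, (i <= n)%nat -> Q2R (c i) * IZR d = IZR (z i).
Proof.
  induction n as [|n [d [z [Hd Hz]]]].
  - exists (Zpos (Qden (c 0%nat))), (fun _ => Qnum (c 0%nat)). split; [discriminate|].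
    intros i Hi. replace i with 0%nat by lia. unfold Q2R. field.
    apply not_0_IZR. discriminate.
  - exists (d * Zpos (Qden (c (S n))))%Z,
      (extend (fun i => z i * Zpos (Qden (c (S n))))%Z (S n) (Qnum (c (S n)) * d)%Z).
    split; [apply Z.neq_mul_0; split; [exact Hd|discriminate]|].
    intros i Hi. rewrite mult_IZR. destruct (Nat.eq_dec i (S n)) as [->|Hne].
    + rewrite extend_eq, mult_IZR. unfold Q2R. field. apply not_0_IZR. discriminate.
    + rewrite extend_neq, mult_IZR, <- (Hz i) by lia. ring.
Qed.

Lemma one_zeta_free_Q k zeta (c : nat -> Q) : (1 <= k)%nat ->
  (forall i, (1 <= i <= k)%nat -> zeta i = Series (reciprocals k i)) ->
  sum_f_R0 (fun i => Q2R (c i) * one_zeta zeta i) k = 0 ->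
  forall i, (i <= k)%nat -> Qeq (c i) 0%Q.
Proof.
  intros Hk Hzeta Hc i Hi. destruct (common_denominator c k) as [d [z [Hd Hz]]].
  assert (Hzi : z i = 0%Z).
  { apply (one_zeta_free_Z k zeta Hk Hzeta); [|exact Hi].
    rewrite <- (Rmult_0_r (IZR d)), <- Hc, scal_sum. apply sum_eq. intros l Hl.
    rewrite <- (Hz l Hl). ring. }
  apply eqR_Qeq. specialize (Hz i Hi). rewrite Hzi in Hz.
  apply Rmult_integral in Hz as [Hz|Hz].
  - rewrite Hz. unfold Q2R. simpl. lra.
  - apply eq_IZR in Hz. contradiction.
Qed.

(** * The array of denominators and the theorem *)

Definition grid (k n j : nat) : nat := den (pred n * k + j).

Lemma den_lt_S m : (1 <= m)%nat -> (den m < den (S m))%nat.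
Proof.
  intros Hm. apply Nat.pow_lt_mono_r; [lia|]. rewrite fact_simpl.
  assert (H := lt_O_fact m). nia.
Qed.

Lemma den_divide_S m : Nat.divide (den m) (den (S m)).
Proof. rewrite den_S. apply Nat.divide_factor_r. Qed.

Lemma bseq_grid k m : (1 <= k)%nat -> bseq k (grid k) (S m) = log_den (S m).
Proof.
  intros Hk. unfold bseq, grid. replace (S m - 1)%nat with m by lia. simpl pred.
  replace (m / k * k + S (m mod k))%nat with (S m).
  - rewrite INR_den. apply ln_exp.
  - assert (H := Nat.div_mod m k ltac:(lia)). lia.
Qed.

Theorem theorem3p2 (k : nat) (hk : (2 <= k)%nat) :
  exists q : nat -> nat -> nat,
    (* positivity and the chain q_{1,1} < ... < q_{1,k} < q_{2,1} < ... *)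
    (forall n j, (1 <= n)%nat -> (1 <= j <= k)%nat -> (0 < q n j)%nat) /\
    (forall n j, (1 <= n)%nat -> (1 <= j < k)%nat -> (q n j < q n (S j))%nat) /\
    (forall n, (1 <= n)%nat -> (q n k < q (S n) 1)%nat) /\
    (* divisibility *)
    (forall n j, (1 <= n)%nat -> (1 <= j <= k - 1)%nat -> Nat.divide (q n j) (q n (S j))) /\
    (forall n, (1 <= n)%nat -> Nat.divide (q n k) (q (S n) 1%nat)) /\
    (* lim b_{m+1} / b_m = +infinity *)
    is_lim_seq (fun m => bseq k q (S (S m)) / bseq k q (S m)) p_infty /\
    (* the series defining zeta_j converge *)
    (forall j, (1 <= j <= k)%nat -> ex_series (fun n => / INR (q (S n) j))) /\
    (* 1, zeta_1, ..., zeta_k are linearly independent over Q *)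
    (forall c : nat -> Q,
       sum_f_R0 (fun i => Q2R (c i) * one_zeta (zeta_of q) i) k = 0 ->
       forall i, (i <= k)%nat -> Qeq (c i) 0%Q) /\
    (* the psi-values *)
    is_liminf_infty (psi k (zeta_of q) 1%nat) (-1) /\
    is_limsup_infty (psi k (zeta_of q) 1%nat) ((1 - INR k) / (2 * INR k)) /\
    is_liminf_infty (psi k (zeta_of q) 2%nat) ((1 - INR k) / (2 * INR k)) /\
    (forall j, (2 <= j <= k)%nat ->
       is_limsup_infty (psi k (zeta_of q) j) (1 / INR k) /\
       is_liminf_infty (psi k (zeta_of q) (S j)) (1 / INR k)) /\
    is_limsup_infty (psi k (zeta_of q) (S k)) (1 / INR k).
Proof.
  assert (Hk : (1 <= k)%nat) by lia.
  (* The shift by [pred] in [grid] cancels the [S n] in [zeta_of], so the two series agree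
     definitionally. *)
  assert (Hzeta : forall i, (1 <= i <= k)%nat ->
    zeta_of (grid k) i = Series (reciprocals k i)) by reflexivity.
  assert (Hev := eventually_good_of_reciprocals k _ Hk Hzeta).
  (* [lam = 2] is where the two exponents coincide, [lam = 1] the left end of the window. *)
  assert (Hmid := frequently_good_of_reciprocals k _ Hk Hzeta 2 ltac:(lra)).
  assert (Hmin := frequently_good_of_reciprocals k _ Hk Hzeta 1 ltac:(lra)).
  rewrite Rdiv_1_r in Hmin.
  assert (Hnext : forall n, (1 <= n)%nat -> (pred (S n) * k + 1 = S (pred n * k + k))%nat)
    by (intros [|n] Hn; simpl; lia).
  exists (grid k).
  refine (conj _ (conj _ (conj _ (conj _ (conj _ (conj _ (conj _ (conj _
    (conj _ (conj _ (conj _ (conj _ _)))))))))))).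
  - intros n j _ _. apply INR_lt. apply INR_den_pos.
  - intros n j _ Hj. unfold grid. rewrite Nat.add_succ_r. apply den_lt_S. nia.
  - intros n Hn. unfold grid. rewrite Hnext by exact Hn. apply den_lt_S. nia.
  - intros n j _ _. unfold grid. rewrite Nat.add_succ_r. apply den_divide_S.
  - intros n Hn. unfold grid. rewrite Hnext by exact Hn. apply den_divide_S.
  (* The factorial recursion makes the ratio of consecutive logarithms exactly [m + 2]. *)
  - apply is_lim_seq_ext with (fun m => INR (m + 2)).
    + intros m. rewrite !bseq_grid, (log_den_S (S m)) by exact Hk.
      assert (H := log_den_ge (S m)). assert (H2 := ln2_pos).
      replace (m + 2)%nat with (S (S m)) by lia. field. lra.
    + apply (is_lim_seq_incr_n INR 2), is_lim_seq_INR.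
  - intros j Hj. apply (ex_series_reciprocals k j); lia.
  - intros c Hc. exact (one_zeta_free_Q k _ c Hk Hzeta Hc).
  - now apply liminf_psi_1.
  - now apply limsup_psi_1.
  - now apply liminf_psi_2.
  - intros j Hj. split; [apply limsup_psi_unit|apply liminf_psi_unit]; try assumption; lia.
  - apply limsup_psi_unit; try assumption; lia.
Qed.
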